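(* Let $\mathcal L\colon\mathbb P(\Gamma,p)\to\mathbb R^m$ be an injective linear map and let $\mathbf\Sigma_p\in\mathbb R^{N_p\times m}$ be the high-order Star matrix $[\mathbf\Sigma_p]_{i,j}=\big[\mathcal L(\nabla_\Gamma\cdot\psi_i^{(p)})\big]_j$. Let $\mathbf\Lambda_p$ and $\mathbf H_p$ be the local-Loops-to-GWP and global-cycles-to-GWP matrices. Then: (1) $\mathbf\Sigma_p^T\mathbf\Lambda_p=\mathbf 0$ and $\mathbf\Sigma_p^T\mathbf H_p=\mathbf 0$; (2) the null space of $\mathbf\Sigma_p^T$ is exactly the set of coefficient vectors (in the GWP basis) of solenoidal functions, and $\mathbf\Sigma_p$ has rank $M_p-N_{\mathrm{bodies}}$; (3) the matrix $[\mathbf\Sigma_p,\mathbf\Lambda_p,\mathbf H_p]$ has rank $N_p$, i.e. its columns generate the coefficient space $\mathbb R^{N_p}$ of the entire GWP space; (4) with $\mathbf P_p^{\Sigma}=\mathbf\Sigma_p(\mathbf\Sigma_p^T\mathbf\Sigma_p)^+\mathbf\Sigma_p^T$, the matrix $\mathbf P_p^{\Lambda H}=\mathbf I-\mathbf P_p^{\Sigma}$ satisfies $\mathbf P_p^{\Sigma}\mathbf P_p^{\Lambda H}=\mathbf P_p^{\Lambda H}\mathbf P_p^{\Sigma}=\mathbf 0$ and is the projector onto the subspace of coefficient vectors of solenoidal functions.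
   Context: $\Gamma$ is a surface meshed by $C$ triangular cells with $E_{\mathrm{int}}$ internal edges, consisting of $N_{\mathrm{bodies}}$ separate connected bodies, and $p\ge 0$ is an integer. $\mathbb P(\Gamma,p)$ is the real vector space of functions on $\Gamma$ that are cell-wise polynomials complete up to order $p$ (polynomial of degree at most $p$ on each cell, with no continuity required across cells); its dimension is $M_p=\frac{(p+1)(p+2)}{2}C$. $\{\psi_n^{(p)}\}_{n=1}^{N_p}$ is the set of order-$p$ Graglia-Wilton-Peterson (GWP) basis functions on the mesh, where $N_p=(p+1)E_{\mathrm{int}}+p(p+1)C$. These are real, linearly independent, tangential, div-conforming vector functions, defined as products of the Rao-Wilton-Glisson (RWG) functions (the zeroth-order GWPs, attached to internal edges) with order-$p$ shifted Silvester-Lagrange polynomials. They form a basis of the order-$p$ Nédélec mixed-order div-conforming space on the mesh (the Raviart-Thomas type space with vanishing normal component on boundary edges). $\nabla_\Gamma\cdot$ is the surface divergence, and $\nabla_\Gamma\cdot\psi_n^{(p)}\in\mathbb P(\Gamma,p)$ for every $n$. A function $\sum_n j_n\psi_n^{(p)}$ is solenoidal if its surface divergence vanishes. The following known fact is assumed: the solenoidal subspace of the span of the GWPs has dimension $N_p-M_p+N_{\mathrm{bodies}}$ (equivalently, the divergences span a space of dimension $M_p-N_{\mathrm{bodies}}$). The columns of $\mathbf\Lambda_p$ and $\mathbf H_p$ (local Loops and global cycles) are GWP coefficient vectors of solenoidal functions, and together they span the coefficient vectors of all solenoidal functions in the GWP space. $\mathbf A^+$ denotes the Moore-Penrose pseudoinverse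 of $\mathbf A$. *)

(* Defs.v *)
From HB Require Import structures.
From mathcomp Require Import all_boot all_order all_algebra.
From mathcomp Require Import reals mpoly.

Set Implicit Arguments.
Unset Strict Implicit.
Unset Printing Implicit Defensive.

Import Order.TTheory GRing.Theory Num.Theory.
Local Open Scope ring_scope.

(* A conforming mesh of flat triangles. The last three fields say that two
   cells meet exactly in the face spanned by their common vertices, that an
   edge lies in at most two cells, and that the cells around a vertex are
   chained through edges containing it, so that the union of the cells is a
   2-manifold, possibly with boundary. *)
Record trimesh (R : realType) := TriMesh {
  vertex : finType;
  cell : finType;
  pos : vertex -> 'rV[R]_3;
  node : cell -> 'I_3 -> vertex;
  cell_nodes (c : cell) : {set vertex} := [set node c l | l : 'I_3];
  edge_cells (e : vertex * vertex) : {set cell} :=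
    [set c | (e.1 \in cell_nodes c) && (e.2 \in cell_nodes c)];
  cell_adj (c d : cell) : bool :=
    (c != d) && (#|cell_nodes c :&: cell_nodes d| == 2)%N;
  node_free : forall c : cell,
    row_free (\matrix_(k < 2)
      (pos (node c (lift ord_max k)) - pos (node c ord_max)));
  cell_nodes_inj : injective cell_nodes;
  cells_conform : forall (c d : cell) (x y : 'I_3 -> R),
    (forall l, 0 <= x l) -> (forall l, 0 <= y l) ->
    \sum_l x l = 1 -> \sum_l y l = 1 ->
    \sum_l x l *: pos (node c l) = \sum_l y l *: pos (node d l) ->
    forall l, 0 < x l -> node c l \in cell_nodes d;
  edge_cells_le2 : forall e : vertex * vertex, e.1 != e.2 ->
    (#|edge_cells e| <= 2)%N;
  vertex_star_connected : forall (v : vertex) (c d : cell),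
    v \in cell_nodes c -> v \in cell_nodes d ->
    connect [rel c1 c2 | [&& v \in cell_nodes c1, v \in cell_nodes c2
                           & cell_adj c1 c2]] c d
}.

Section Mesh.
Variables (R : realType) (M : trimesh R).

(* Each edge occurs once, as a pair of vertices increasing for the
   enumeration order. *)
Definition is_int_edge (e : vertex M * vertex M) : bool :=
  (enum_rank e.1 < enum_rank e.2)%N && (#|edge_cells e| == 2)%N.

Definition int_edge := {e : vertex M * vertex M | is_int_edge e}.

(* Cells touching only at a vertex are nevertheless linked by adjacent cells
   (vertex_star_connected), so these are the topological components. *)
Definition num_bodies : nat := n_comp (@cell_adj R M) {: cell M}.

Definition Np (p : nat) : nat :=
  (p.+1 * #|{: int_edge}| + p * p.+1 * #|{: cell M}|)%N.

Definition Mp (p : nat) : nat := ((p.+1 * p.+2)./2 * #|{: cell M}|)%N.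

(* A polynomial function on a triangle is identified with the polynomial
   expressing it in the barycentric coordinates xi_0 = 'X_0 and xi_1 = 'X_1;
   this change of variable is affine and invertible, so it preserves the
   total degree. A function or field has one polynomial per cell, with no
   relation between the values on both sides of an edge. *)
Definition sfield := {ffun cell M -> {mpoly R[2]}}.
Definition vfield := {ffun cell M -> {ffun 'I_3 -> {mpoly R[2]}}}.

Definition pwpoly_pred (p : nat) : {pred sfield} :=
  fun f => [forall c, (msize (f c) <= p.+1)%N].

Fact pwpoly_submod_closed p : submod_closed (pwpoly_pred p).
Proof.
split; first by apply/forallP => c; rewrite ffunE msize0.
move=> a f g /forallP hf /forallP hg; apply/forallP => c; rewrite !ffunE.
apply: leq_trans (msizeD_le _ _) _; rewrite geq_max hg andbT.
exact: leq_trans (msizeZ_le _ _) (hf c).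
Qed.

HB.instance Definition _ p :=
  GRing.isSubmodClosed.Build R sfield (pwpoly_pred p) (pwpoly_submod_closed p).

Record pwpoly (p : nat) := PWPoly {
  sfield_of_pwpoly :> sfield;
  _ : sfield_of_pwpoly \in pwpoly_pred p
}.

HB.instance Definition _ p := [isSub for @sfield_of_pwpoly p].
HB.instance Definition _ p := [Choice of pwpoly p by <:].
HB.instance Definition _ p := [SubChoice_isSubLmodule of pwpoly p by <:].

(* Barycentric coordinates xi_0, xi_1 and xi_2 = 1 - xi_0 - xi_1. *)
Definition bary (l : 'I_3) : {mpoly R[2]} :=
  if unlift ord_max l is Some k then 'X_k else 1 - \sum_(k < 2) 'X_k.

(* The rows are the tangent vectors dr/dxi_0 and dr/dxi_1. *)
Definition tangents (c : cell M) : 'M[R]_(2, 3) :=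
  \matrix_(k < 2) (pos (node c (lift ord_max k)) - pos (node c ord_max)).

(* The rows are the surface gradients of xi_0 and xi_1, i.e. the basis of the
   tangent plane dual to the tangent vectors. *)
Definition bary_grad (c : cell M) : 'M[R]_(2, 3) :=
  invmx (tangents c *m (tangents c)^T) *m tangents c.

(* div u = \sum_k (grad xi_k) . (du/dxi_k) *)
Definition sdiv (u : vfield) : sfield :=
  [ffun c => \sum_(k < 2) \sum_(x < 3) bary_grad c k x *: mderiv k (u c x)].

Definition vnorm (v : 'rV[R]_3) : R := Num.sqrt (\sum_(x < 3) v 0 x ^+ 2).

Definition opp_edge_len (c : cell M) (b : 'I_3) : R :=
  vnorm (pos (node c (lift b 0)) - pos (node c (lift b 1))).

Definition area (c : cell M) : R :=
  Num.sqrt (\det (tangents c *m (tangents c)^T)) / 2.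

(* l_b / (2 A) (r - r_b), where r_b is the position of node b of c and l_b the
   length of the edge opposite to it. *)
Definition half_rwg (c : cell M) (b : 'I_3) : {ffun 'I_3 -> {mpoly R[2]}} :=
  [ffun x : 'I_3 => (opp_edge_len c b / (2 * area c)) *:
     (\sum_(l < 3) pos (node c l) 0 x *: bary l - (pos (node c b) 0 x)%:MP)].

(* Of the two cells sharing an interior edge, the positive one is the first in
   the enumeration order. *)
Definition edge_sign (e : int_edge) (c : cell M) : R :=
  if [exists d in edge_cells (val e), (enum_rank d < enum_rank c)%N]
  then -1 else 1.

(* When c contains the edge, the sum has exactly one term, given by the node
   opposite to the edge. *)
Definition rwg (e : int_edge) : vfield :=
  [ffun c => if c \in edge_cells (val e) then
     edge_sign e c *: \sum_(b < 3 | node c b \notin [:: (val e).1; (val e).2])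
                        half_rwg c b
   else 0].

Definition silvester (n i : nat) (x : {mpoly R[2]}) : {mpoly R[2]} :=
  (i`!%:R)^-1 *: \prod_(0 <= k < i) (n%:R *: x - k%:R).

(* This is 1 for i = 1, and also for i = 0: at a node of an edge, the opposite
   vertex contributes the trivial factor. *)
Definition shifted_silvester (n i : nat) (x : {mpoly R[2]}) : {mpoly R[2]} :=
  (i.-1`!%:R)^-1 *: \prod_(1 <= k < i) (n%:R *: x - k%:R).

(* Interpolation nodes interior to a cell: the points of barycentric
   coordinates m / (p + 2). *)
Definition is_inode p (m : {ffun 'I_3 -> 'I_p.+1}) : bool :=
  [forall l, (0 < m l)%N] && (\sum_l m l == p.+2)%N.

Definition inode p := {m : {ffun 'I_3 -> 'I_p.+1} | is_inode m}.

(* The interpolation nodes of the edge (a, b) are the points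
   ((i + 1) a + (p + 1 - i) b) / (p + 2), 0 <= i <= p. *)
Definition edge_mult p (e : int_edge) (i : 'I_p.+1) (v : vertex M) : nat :=
  if v == (val e).1 then i.+1 else if v == (val e).2 then (p.+1 - i)%N else 0%N.

(* At an interior edge, there is one function per node of the edge. At a node
   interior to a cell, there is one candidate function for each of the three
   edges of the cell; the three are linearly dependent and one keeps two. *)
Definition gwp_index (p : nat) : finType :=
  (int_edge * 'I_p.+1 + cell M * inode p * 'I_2)%type.

Definition pscale (f : {mpoly R[2]}) (u : {ffun 'I_3 -> {mpoly R[2]}}) :
  {ffun 'I_3 -> {mpoly R[2]}} := [ffun x => f * u x].

Definition gwp_edge_poly p (e : int_edge) (i : 'I_p.+1) (c : cell M) :
    {mpoly R[2]} :=
  \prod_(l < 3) shifted_silvester p.+2 (edge_mult e i (node c l)) (bary l).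

Definition gwp_cell_poly p (m : inode p) (b : 'I_3) : {mpoly R[2]} :=
  silvester p.+2 (val m b) (bary b) *
  \prod_(l < 3 | l != b) shifted_silvester p.+2 (val m l) (bary l).

(* drop tells which of the three candidates is discarded at each node interior
   to a cell; w is an arbitrary normalization, which also covers the choice of
   the reference direction across each interior edge. *)
Definition gwp_field p (drop : cell M -> inode p -> 'I_3)
    (w : gwp_index p -> R) (n : gwp_index p) : vfield :=
  w n *: match n with
         | inl (e, i) => [ffun c => pscale (gwp_edge_poly e i c) (rwg e c)]
         | inr (c0, m, k) =>
             let b := lift (drop c0 m) k in
             [ffun c => if c == c0 then pscale (gwp_cell_poly m b) (half_rwg c b)
                        else 0]
         end.

End Mesh.

Lemma card_inode p : (#|{: inode p}| * 2 = p * p.+1)%N.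
Proof.
pose Q (ij : 'I_p.+1 * 'I_p.+1) :=
  [&& 0 < ij.1, 0 < ij.2 & ij.1 + ij.2 <= p.+1]%N.
pose f (m : {ffun 'I_3 -> 'I_p.+1}) : 'I_p.+1 * 'I_p.+1 := (m 0, m 1).
have sum3 (m : {ffun 'I_3 -> 'I_p.+1}) :
    (\sum_l m l = m 0%R + (m 1%R + m ord_max))%N.
  rewrite !big_ord_recl big_ord0 addn0; do 2?congr (_ + _)%N;
  by congr (nat_of_ord (m _)); apply: val_inj.
have -> : #|{: inode p}| = #|[pred ij | Q ij]|.
  rewrite card_sig.
  have injf : {in [pred m | is_inode m] &, injective f}.
    move=> m m'; rewrite !inE => /andP[_ /eqP s] /andP[_ /eqP s'] [e0 e1].
    have e2 : m ord_max = m' ord_max.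
      apply: val_inj; apply/eqP; rewrite -(eqn_add2l (m 1%R)).
      by rewrite -(eqn_add2l (m 0%R)) -sum3 s e0 e1 -sum3 s'.
    apply/ffunP => l.
    case: (unliftP ord_max l) => [j|] -> //.
    have [->|->] : j = 0 \/ j = 1.
      by case: j => [[|[|//]]] ?; [left|right]; apply: val_inj.
      by rewrite (_ : lift _ _ = 0) //; apply: val_inj.
    by rewrite (_ : lift _ _ = 1) //; apply: val_inj.
  rewrite -(card_in_image injf); apply: eq_card => -[i j].
  rewrite !inE /Q /=; apply/imageP/and3P.
    move=> [m]; rewrite inE => /andP[/forallP m0 /eqP s] [-> ->].
    by split; rewrite ?m0 // -ltnS -s sum3 addnA -[ltnLHS]addn0 ltn_add2l m0.
  move=> [i0 j0 ij].
  have kp : (p.+2 - (i + j) < p.+1)%N.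
    rewrite ltn_subLR; last exact: leqW.
    have : (2 + p.+1 <= i + j + p.+1)%N by rewrite leq_add2r (leq_add i0 j0).
    by [].
  pose m := [ffun l : 'I_3 => if l == 0 then i else if l == 1 then j
                              else Ordinal kp].
  exists m; last by rewrite /f !ffunE.
  rewrite inE; apply/andP; split.
    apply/forallP => l; rewrite ffunE; case: ifP => // _; case: ifP => // _ /=.
    by rewrite subn_gt0.
  by rewrite sum3 !ffunE /= addnA subnKC // leqW.
rewrite -sum1_card.
have -> : (\sum_(ij in [pred ij | Q ij]) 1 =
           \sum_(i < p.+1) \sum_(j < p.+1 | [&& 0 < i, 0 < j & i + j <= p.+1]) 1)%N.
  by rewrite pair_big_dep /=; apply: eq_bigl => -[i j]; rewrite inE.
have inner n k : (k < n)%N -> (\sum_(j < n | (0 < j) && (j <= k)) 1 = k)%N.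
  move=> kn.
  rewrite -(big_mkord (fun j => (0 < j) && (j <= k))%N (fun=> 1%N)).
  rewrite (big_cat_nat _ (n := k.+1)) //= [X in (_ + X)%N]big_nat_cond.
  rewrite [X in (_ + X)%N]big_pred0 ?addn0; last first.
    move=> j; apply/negP => /andP[/andP[kj _] /andP[_]].
    by rewrite leqNgt kj.
  rewrite big_ltn_cond //= big_nat_cond (eq_bigl (fun j => (1 <= j < k.+1)%N)).
    by rewrite -big_nat sum_nat_const_nat muln1 subn1.
  by move=> j; rewrite ltnS; case: (0 < j)%N => //=; rewrite andbb.
rewrite big_ord_recl /= big_pred0 // add0n.
rewrite (eq_bigr (fun i : 'I_p => p - i)%N); last first.
  move=> i _; rewrite -(inner p.+1 (p - i)%N) ?ltnS ?leq_subr //.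
  apply: eq_bigl => j; congr andb.
  by rewrite /bump addSn ltnS leq_subRL // ltnW.
rewrite (reindex_inj rev_ord_inj) /=.
rewrite (eq_bigr (fun i : 'I_p => i.+1)); last by move=> i _; rewrite subKn.
elim: p {Q f sum3} => [|p IH]; first by rewrite big_ord0.
by rewrite big_ord_recr /= mulnDl IH (mulnC p) -mulnDr addn2.
Qed.

Lemma card_gwp_index (R : realType) (M : trimesh R) p :
  #|gwp_index M p| = Np M p.
Proof.
rewrite /gwp_index /Np card_sum !card_prod !card_ord -mulnA card_inode.
by rewrite mulnC [X in (_ + X)%N]mulnC.
Qed.

Section Degree.
Variables (R : realType).
Implicit Types (f g : {mpoly R[2]}).

Lemma msize_leP f (k : nat) :
  reflect (forall m, f@_m != 0 -> (mdeg m < k)%N) (msize f <= k)%N.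
Proof.
apply: (iffP idP) => [hf m|hf].
  by rewrite -mcoeff_msupp => /msize_mdeg_lt /leq_trans; apply.
by rewrite msizeE; apply/bigmax_leqP_seq => m; rewrite mcoeff_msupp => /hf.
Qed.

Lemma msizeM_leD f g a b : (msize f <= a.+1)%N -> (msize g <= b.+1)%N ->
  (msize (f * g) <= (a + b).+1)%N.
Proof.
move=> hf hg; apply/msize_leP => m; rewrite -mcoeff_msupp => /msuppM_le.
case/allpairsP => -[m1 m2] /= [h1 h2 ->]; rewrite mdegD ltnS leq_add //.
  by rewrite -ltnS (leq_trans (msize_mdeg_lt h1)).
by rewrite -ltnS (leq_trans (msize_mdeg_lt h2)).
Qed.

Lemma msize_mderiv f i k : (msize f <= k.+1)%N -> (msize (mderiv i f) <= k)%N.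
Proof.
move=> hf; apply/msize_leP => m; rewrite mcoeff_deriv => nz.
have : f@_(m + U_(i)) != 0 by apply: contraNneq nz => ->; rewrite mul0rn.
by move/(msize_leP _ _ hf); rewrite mdegD mdeg1 addn1 ltnS.
Qed.

Lemma msizeZ_lek f a k : (msize f <= k)%N -> (msize (a *: f) <= k)%N.
Proof. exact/leq_trans/msizeZ_le. Qed.

Lemma msizeC_le (a : R) k : (msize (a%:MP : {mpoly R[2]}) <= k.+1)%N.
Proof. by rewrite msizeC; case: eqP. Qed.

Lemma msize_sum_le (I : Type) (r : seq I) (P : pred I) (F : I -> {mpoly R[2]}) k :
  (forall i, P i -> msize (F i) <= k)%N ->
  (msize (\sum_(i <- r | P i) F i) <= k)%N.
Proof.
move=> h; elim/big_ind: _ => [|f g hf hg|]; rewrite ?msize0 //.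
by apply: leq_trans (msizeD_le _ _) _; rewrite geq_max hf.
Qed.

Lemma msizeB_le f g k : (msize f <= k)%N -> (msize g <= k)%N ->
  (msize (f - g) <= k)%N.
Proof.
move=> hf hg; apply: leq_trans (msizeD_le _ _) _.
by rewrite geq_max hf msizeN.
Qed.

Lemma msize_bary l : (msize (bary R l) <= 2)%N.
Proof.
have hX k : (msize ('X_k : {mpoly R[2]}) <= 2)%N by rewrite msizeX mdeg1.
rewrite /bary; case: unlift => [k|]; first exact: hX.
by apply: msizeB_le; [exact: (msizeC_le 1) | apply: msize_sum_le].
Qed.

Lemma msize_prod_nat (F : nat -> {mpoly R[2]}) a b :
  (forall k, msize (F k) <= 2)%N ->
  (msize (\prod_(a <= k < b) F k) <= (b - a).+1)%N.
Proof.
move=> h; elim: b => [|b IH]; first by rewrite big_geq ?msize1.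
have [ab|ba] := leqP a b; last by rewrite big_geq ?msize1.
by rewrite big_nat_recr //= subSn // -(addn1 (b - a)) msizeM_leD.
Qed.

Lemma msize_silvester_factor n k f :
  (msize f <= 2)%N -> (msize (n%:R *: f - k%:R) <= 2)%N.
Proof.
move=> hf; apply: msizeB_le; first exact: msizeZ_lek.
by rewrite -mpolyC_nat msizeC_le.
Qed.

Lemma msize_silvester n i f :
  (msize f <= 2)%N -> (msize (silvester n i f) <= i.+1)%N.
Proof.
move=> hf; apply: msizeZ_lek; rewrite -{2}[i]subn0.
by apply: msize_prod_nat => k; apply: msize_silvester_factor.
Qed.

Lemma msize_shifted_silvester n i f :
  (msize f <= 2)%N -> (msize (shifted_silvester n i f) <= i.-1.+1)%N.
Proof.
move=> hf; apply: msizeZ_lek; rewrite -subn1.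
by apply: msize_prod_nat => k; apply: msize_silvester_factor.
Qed.

Lemma msize_prod_le (I : Type) (r : seq I) (P : pred I) (F : I -> {mpoly R[2]})
    (d : I -> nat) :
  (forall i, P i -> msize (F i) <= (d i).+1)%N ->
  (msize (\prod_(i <- r | P i) F i) <= (\sum_(i <- r | P i) d i).+1)%N.
Proof.
move=> h; elim/big_ind2: _ => [|f a g b hf hg|]; rewrite ?msize1 //.
exact: msizeM_leD.
Qed.

Variables (M : trimesh R) (p : nat).

Lemma msize_half_rwg (c : cell M) b x : (msize (half_rwg c b x) <= 2)%N.
Proof.
rewrite ffunE; apply/msizeZ_lek/msizeB_le; last exact: msizeC_le.
by apply: msize_sum_le => l _; apply/msizeZ_lek/msize_bary.
Qed.

Lemma msize_rwg (e : int_edge M) c x : (msize (rwg e c x) <= 2)%N.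
Proof.
rewrite ffunE; case: ifP => _; last by rewrite ffunE msize0.
rewrite ffunE; apply: msizeZ_lek; rewrite sum_ffunE.
by apply: msize_sum_le => b _; apply: msize_half_rwg.
Qed.

Lemma node_inj (c : cell M) : injective (node c).
Proof.
have main (a b : 'I_3) : a != b -> node c a = node c b -> False.
  move=> ab eab; have /row_freeP[D hD] := node_free c.
  pose t l : 'rV[R]_3 := pos (node c l) - pos (node c ord_max).
  pose z (l : 'I_3) : R := (l == a)%:R - (l == b)%:R.
  pose u : 'rV[R]_2 := \row_k z (lift ord_max k).
  have u0 : u = 0.
    suff : u *m (\matrix_(k < 2)
      (pos (node c (lift ord_max k)) - pos (node c ord_max))) = 0.
      by move/(congr1 (mulmx^~ D)); rewrite -mulmxA hD mulmx1 mul0mx.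
    rewrite mulmx_sum_row.
    under eq_bigr => k _ do rewrite rowK mxE.
    transitivity (\sum_l z l *: t l).
      rewrite [RHS](bigD1 ord_max) //= /t subrr scaler0 add0r.
      rewrite [RHS](reindex_omap (lift ord_max) (unlift ord_max)); last first.
        by move=> l; rewrite eq_sym => /unlift_some[k -> ->].
      by apply: eq_bigl => k; rewrite liftK eqxx andbT eq_sym neq_lift.
    under eq_bigr => l _ do rewrite scalerBl.
    rewrite sumrB (bigD1 a) //= big1 => [|l /negPf ->]; last by rewrite scale0r.
    rewrite (bigD1 b) //= [X in _ - (_ + X)]big1 => [|l /negPf ->]; last first.
      by rewrite scale0r.
    by rewrite !eqxx /t eab !addr0 subrr.
  have zk k : z (lift ord_max k) = 0.
    by move/rowP/(_ k): u0; rewrite !mxE.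
  have : z a <> 0.
    by rewrite /z eqxx (negPf ab) subr0; apply/eqP/oner_neq0.
  have : z b <> 0.
    rewrite /z eqxx eq_sym (negPf ab) sub0r.
    by apply/eqP; rewrite oppr_eq0 oner_neq0.
  case: (unliftP ord_max a) => [k ->|ea]; first by rewrite zk.
  case: (unliftP ord_max b) => [k ->|eb]; first by rewrite zk.
  by move: ab; rewrite ea eb eqxx.
move=> a b eab; have [//|ab] := eqVneq a b.
by case: (main a b ab eab).
Qed.

Lemma sum_edge_mult (e : int_edge M) (i : 'I_p.+1) (c : cell M) :
  (\sum_(l < 3) (edge_mult e i (node c l)).-1 <= p)%N.
Proof.
have -> : (\sum_(l < 3) (edge_mult e i (node c l)).-1 =
           \sum_(v in [set node c l | l : 'I_3]) (edge_mult e i v).-1)%N.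
  by rewrite big_imset => [|l l' _ _ /node_inj //]; apply: eq_bigl.
apply: (@leq_trans (\sum_v (edge_mult e i v).-1)).
  by rewrite [leqRHS](bigID (mem [set node c l | l : 'I_3])) /= leq_addr.
have ne : (val e).2 != (val e).1.
  have /andP[lt _] := valP e; apply: contraTneq lt => ->.
  by rewrite ltnn.
rewrite (bigD1 (val e).1) //= (bigD1 (val e).2) //= big1 => [|v /andP[h1 h2]].
  rewrite /edge_mult !eqxx (negPf ne) /= addn0 subSn ?subnKC //.
    by rewrite -ltnS.
  by rewrite -ltnS.
by rewrite /edge_mult (negPf h1) (negPf h2).
Qed.

Lemma msize_gwp_edge_poly (e : int_edge M) (i : 'I_p.+1) c :
  (msize (gwp_edge_poly e i c) <= p.+1)%N.
Proof.
have hd l : predT l -> (msize (shifted_silvester p.+2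
    (edge_mult e i (node c l)) (bary R l)) <=
    ((edge_mult e i (node c l)).-1).+1)%N.
  by move=> _; apply/msize_shifted_silvester/msize_bary.
by apply: leq_trans (msize_prod_le _ hd) _; rewrite ltnS sum_edge_mult.
Qed.

Lemma msize_gwp_cell_poly (m : inode p) b :
  (msize (gwp_cell_poly R m b) <= p.+1)%N.
Proof.
have hd l : l != b -> (msize (shifted_silvester p.+2 (val m l) (bary R l)) <=
    ((val m l).-1).+1)%N.
  by move=> _; apply/msize_shifted_silvester/msize_bary.
apply: leq_trans (msizeM_leD (msize_silvester _ _ (msize_bary b))
                             (msize_prod_le _ hd)) _.
have /andP[/forallP m0 /eqP s] := valP m.
rewrite ltnS -(leq_add2r (1 + 1)) [leqRHS]addn2 -s [leqRHS](bigD1 b) //= -addnA leq_add2l.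
have <- : (\sum_(l < 3 | l != b) 1 = 1 + 1)%N.
  by rewrite sum1_card (eq_card (B := predC1 b)) // cardC1 card_ord.
rewrite -big_split /=; apply: leq_sum => l _.
by rewrite addn1 prednK.
Qed.

Lemma msize_gwp_field drop (w : gwp_index M p -> R) n c x :
  (msize (gwp_field drop w n c x) <= p.+2)%N.
Proof.
have scaleE a (u : vfield M) : (a *: u) c x = a *: u c x by rewrite !ffunE.
have pscaleE f u : pscale f u x = f * u x by rewrite ffunE.
rewrite /gwp_field scaleE; apply: msizeZ_lek; rewrite -[p.+2]/((1 + p).+1) addnC.
case: n => [[e i]|[[c0 m] k]].
  by rewrite ffunE pscaleE msizeM_leD ?msize_gwp_edge_poly ?msize_rwg.
rewrite ffunE; case: ifP => _; last by rewrite ffunE msize0.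
by rewrite pscaleE msizeM_leD ?msize_gwp_cell_poly ?msize_half_rwg.
Qed.

Lemma sdiv_gwp_field_pwpoly drop (w : gwp_index M p -> R) n :
  sdiv (gwp_field drop w n) \in @pwpoly_pred R M p.
Proof.
apply/forallP => c; rewrite ffunE.
apply: msize_sum_le => k _; apply: msize_sum_le => x _.
by apply/msizeZ_lek/msize_mderiv/msize_gwp_field.
Qed.

End Degree.

Section Basis.
Variables (R : realType) (M : trimesh R) (p : nat).
Variables (drop : cell M -> inode p -> 'I_3) (w : gwp_index M p -> R).

Definition gwp (n : 'I_(Np M p)) : vfield M :=
  gwp_field drop w (enum_val (cast_ord (esym (card_gwp_index M p)) n)).

Definition div_gwp (n : 'I_(Np M p)) : pwpoly M p :=
  PWPoly (sdiv_gwp_field_pwpoly drop w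
            (enum_val (cast_ord (esym (card_gwp_index M p)) n))).

Definition gwp_comb (j : 'cV[R]_(Np M p)) : vfield M :=
  \sum_n j n 0 *: gwp n.

Definition solenoidal (u : vfield M) : Prop := sdiv u = 0.

Definition solenoidal_coef (j : 'cV[R]_(Np M p)) : Prop :=
  solenoidal (gwp_comb j).

Definition gwp_solenoidal (u : vfield M) : Prop :=
  (exists j, u = gwp_comb j) /\ solenoidal u.

Definition star_mx m (L : {linear pwpoly M p -> 'rV[R]_m}) :
  'M[R]_(Np M p, m) := \matrix_(i, j) L (div_gwp i) 0 j.

End Basis.

Definition has_dim (K : fieldType) (V : lmodType K) (S : V -> Prop) (d : nat) :
    Prop :=
  exists b : 'I_d -> V,
    (forall a : 'I_d -> K, \sum_i a i *: b i = 0 -> forall i, a i = 0) /\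
    (forall v, S v <-> exists a : 'I_d -> K, v = \sum_i a i *: b i).

Definition penrose (R : realType) m n (A : 'M[R]_(m, n)) (X : 'M[R]_(n, m)) :
    bool :=
  [&& A *m X *m A == A, X *m A *m X == X,
      (A *m X)^T == A *m X & (X *m A)^T == X *m A].

Section MoorePenrose.
Variable R : realType.

Lemma gram_unitmx m n (B : 'M[R]_(m, n)) : row_free B -> B *m B^T \in unitmx.
Proof.
move=> freeB; rewrite -row_free_unit -kermx_eq0; apply/rowV0P => u.
move/sub_kermxP; rewrite mulmxA => h.
have: (u *m B) *m (u *m B)^T = 0 by rewrite trmx_mul !mulmxA h mul0mx.
move/matrixP/(_ 0 0); rewrite !mxE => /eqP.
rewrite psumr_eq0 => [/allP z|k _]; last by rewrite [_^T _ _]mxE -expr2 sqr_ge0.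
apply: (row_free_inj freeB); rewrite mul0mx; apply/rowP => k; rewrite [RHS]mxE.
have /eqP := z k (mem_index_enum k).
by rewrite [_^T _ _]mxE => /eqP; rewrite mulf_eq0 orbb => /eqP.
Qed.

Lemma penrose_mul m r n (C : 'M[R]_(m, r)) (B : 'M[R]_(r, n)) :
  row_free B -> row_free C^T ->
  penrose (C *m B) (B^T *m invmx (B *m B^T) *m (invmx (C^T *m C) *m C^T)).
Proof.
move=> /gram_unitmx uB /gram_unitmx; rewrite trmxK => uC.
set X := _ *m (_ *m C^T).
have EAX : C *m B *m X = C *m invmx (C^T *m C) *m C^T.
  rewrite /X !mulmxA -[C *m B *m B^T]mulmxA.
  by rewrite -[C *m _ *m _]mulmxA mulmxV // mulmx1.
have EXA : X *m (C *m B) = B^T *m invmx (B *m B^T) *m B.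
  rewrite /X !mulmxA -[_ *m C^T *m C]mulmxA.
  by rewrite -[_ *m (C^T *m C)]mulmxA mulVmx // mulmx1.
have symV k (G : 'M[R]_k) : G^T = G -> (invmx G)^T = invmx G.
  by move=> sG; rewrite trmx_inv sG.
apply/and4P; split; apply/eqP.
- rewrite EAX !mulmxA -[_ *m C^T *m C]mulmxA.
  by rewrite -[_ *m (C^T *m C)]mulmxA mulVmx // mulmx1.
- rewrite EXA /X !mulmxA -[_ *m B *m B^T]mulmxA.
  by rewrite -[_ *m (B *m B^T)]mulmxA mulVmx // mulmx1.
- by rewrite EAX !trmx_mul trmxK symV ?mulmxA // trmx_mul trmxK.
- by rewrite EXA !trmx_mul trmxK symV ?mulmxA // trmx_mul trmxK.
Qed.

Lemma penrose_exists m n (A : 'M[R]_(m, n)) : exists X, penrose A X.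
Proof.
have := penrose_mul (row_base_free A) (C := col_base A).
rewrite mulmx_base => h; eexists; apply: h.
by rewrite /row_free mxrank_tr; apply: col_base_full.
Qed.

Definition mpinv m n (A : 'M[R]_(m, n)) : 'M[R]_(n, m) :=
  xchoose (penrose_exists A).

Lemma mpinvP m n (A : 'M[R]_(m, n)) : penrose A (mpinv A).
Proof. exact: xchooseP. Qed.

Lemma penrose_uniq m n (A : 'M[R]_(m, n)) X Y :
  penrose A X -> penrose A Y -> X = Y.
Proof.
case/and4P=> /eqP x1 /eqP x2 /eqP x3 /eqP x4.
case/and4P=> /eqP y1 /eqP y2 /eqP y3 /eqP y4.
have e1 : A *m X = A *m Y.
  rewrite -x3 -{1}y1 -[A *m Y *m A *m X]mulmxA trmx_mul x3 y3.
  by rewrite mulmxA x1.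
have e2 : X *m A = Y *m A.
  rewrite -x4 -{1}y1 !mulmxA -[X *m A *m Y *m A]mulmxA trmx_mul x4 y4.
  by rewrite -mulmxA [A *m (X *m A)]mulmxA x1.
by rewrite -x2 e2 -mulmxA e1 mulmxA y2.
Qed.

End MoorePenrose.

(* With no complement specified, the projector onto S is the orthogonal one,
   hence the symmetry. *)
Definition is_projector_onto (R : realType) n (P : 'M[R]_n)
    (S : 'cV[R]_n -> Prop) : Prop :=
  [/\ P *m P = P, P^T = P & forall x, S x <-> exists y, x = P *m y].

(* Main.v *)
(** The key point is that the GWP functions are linearly independent. On a cell,
    a vanishing combination reads sum_b g_b K_b (r - r_b) = 0 with polynomials
    g_b and constants K_b <> 0, and the affine independence of the nodes turns
    it into K_l g_l = xi_l sum_b K_b g_b for each l. The shifted Silvester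
    polynomials are triangular with respect to the interpolation nodes. At the
    nodes of an edge the opposite xi_l vanishes, which kills the edge
    coefficients; at an interior node the discarded candidate has g_l = 0, so
    the common factor sum_b K_b g_b vanishes, which kills the two coefficients
    kept there. Hence solenoidal functions and solenoidal coefficient vectors
    have the same dimension. The rest is linear algebra: by injectivity of L,
    the kernel of Sigma^T is the space of solenoidal coefficient vectors, and
    Sigma (Sigma^T Sigma)^+ Sigma^T is the orthogonal projector onto its
    orthogonal complement. *)

Require Import Defs.
From mathcomp Require Import all_boot all_order all_algebra.
From mathcomp Require Import reals mpoly.
From mathcomp Require Import ring zify.

Import Order.TTheory GRing.Theory Num.Theory.
Local Open Scope ring_scope.


(** * Nondegenerate triangles and the local relation between half RWG functions *)

Section Geometry.
Context {R : realType} {M : trimesh R}.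

(** Eliminating the weight of the last node turns the relation into one between the two tangent
    rows, which [node_free] makes independent. *)
Lemma affine_free (c : cell M) (z : 'I_3 -> R) :
  \sum_l z l = 0 -> \sum_l z l *: pos (node c l) = 0 -> forall l, z l = 0.
Proof.
rewrite (bigD1_ord ord_max) //= => /eqP; rewrite addr_eq0 => /eqP zmax.
rewrite (bigD1_ord ord_max) //= zmax scaleNr scaler_suml addrC -sumrB => h.
have zk k : z (lift ord_max k) = 0.
  pose u : 'rV[R]_2 := \row_k z (lift ord_max k).
  suff: u = 0 by move/rowP/(_ k); rewrite !mxE.
  apply: (row_free_inj (node_free c)); rewrite mul0mx -[RHS]h mulmx_sum_row.
  by apply: eq_bigr => j _; rewrite rowK mxE scalerBr.
by move=> l; case: (unliftP ord_max l) => [k|] ->; rewrite ?zmax ?big1 ?oppr0.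
Qed.

(** A zero length would make two nodes coincide, an affine relation with weights 1 and -1. *)
Lemma opp_edge_len_neq0 (c : cell M) b : opp_edge_len c b != 0.
Proof.
set x := lift b 0; set y := lift b 1.
have xy : x != y by rewrite (inj_eq lift_inj).
apply/eqP => /eqP; rewrite sqrtr_eq0 => le0.
have pick (V : lmodType R) (F : 'I_3 -> V) i :
    \sum_l (l == i)%:R *: F l = F i.
  by rewrite (bigD1 i) //= big1 ?eqxx ?scale1r ?addr0 // => l /negPf ->; rewrite scale0r.
suff: (x == x)%:R - (x == y)%:R = 0 :> R.
  by rewrite eqxx (negPf xy) subr0 => /eqP; rewrite oner_eq0.
apply: (affine_free c (fun l => (l == x)%:R - (l == y)%:R)).
  rewrite sumrB; apply/eqP; rewrite subr_eq0; apply/eqP.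
  have e i : \sum_(l < 3) (l == i)%:R = 1 :> R.
    by rewrite -[RHS](pick R^o (fun=> 1) i); apply: eq_bigr => l _; rewrite [RHS]mulr1.
  by rewrite !e.
under eq_bigr => l _ do rewrite scalerBl.
rewrite sumrB !pick; apply/rowP => k; rewrite [RHS]mxE.
have s0 j : 0 <= (pos (node c x) - pos (node c y)) 0 j ^+ 2 by apply: sqr_ge0.
have /eqP : \sum_(j < 3) (pos (node c x) - pos (node c y)) 0 j ^+ 2 = 0.
  by apply/eqP; rewrite eq_le le0 sumr_ge0.
rewrite psumr_eq0 // => /allP/(_ k (mem_index_enum _)).
by rewrite sqrf_eq0 => /eqP.
Qed.

(** Cauchy-Binet: the Gram determinant is the sum of the squares of the three 2 x 2 minors. Strict
    positivity then rules out that the square root in [area] vanishes. *)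
Lemma gram_det_ge0 (A : 'M[R]_(2, 3)) : 0 <= \det (A *m A^T).
Proof.
have sum3 (F : 'I_3 -> R) : \sum_l F l = F 0 + F 1 + F ord_max.
  rewrite !big_ord_recl big_ord0 addr0 addrA.
  by congr (_ + F _ + F _); apply: val_inj.
have det2 (B : 'M[R]_2) : \det B = B 0 0 * B 1 1 - B 0 1 * B 1 0.
  rewrite (expand_det_row _ 0) !big_ord_recl big_ord0 /cofactor !det_mx11 !mxE /=.
  have -> : lift 0 0 = 1 :> 'I_2 by apply: val_inj.
  have -> : lift 1 0 = 0 :> 'I_2 by apply: val_inj.
  by rewrite /= expr0 expr1 addr0 mul1r mulN1r mulrN.
rewrite det2 !mxE !sum3 !mxE.
set a := A 0 0; set b := A 0 1; set c := A 0 _.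
set d := A 1 0; set e := A 1 1; set f := A 1 _.
rewrite [leRHS](_ : _ = (a * e - b * d) ^+ 2 + (a * f - c * d) ^+ 2
                        + (b * f - c * e) ^+ 2); last by ring.
by rewrite !addr_ge0 ?sqr_ge0.
Qed.

Lemma area_neq0 (c : cell M) : area c != 0.
Proof.
rewrite mulf_neq0 ?invr_eq0 ?pnatr_eq0 // sqrtr_eq0 -ltNge lt_neqAle.
rewrite gram_det_ge0 andbT eq_sym -unitfE -unitmxE.
exact: gram_unitmx (node_free c).
Qed.

(** The constant K_b of the overview, in front of r - r_b. *)
Definition rwg_scale (c : cell M) (b : 'I_3) : R := opp_edge_len c b / (2 * area c).

Lemma rwg_scale_neq0 c b : rwg_scale c b != 0.
Proof.
by rewrite mulf_neq0 ?opp_edge_len_neq0 // invr_eq0 mulf_neq0 ?area_neq0 ?pnatr_eq0.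
Qed.

Lemma sum_bary : \sum_l bary R l = 1.
Proof.
rewrite (bigD1_ord ord_max) //= [bary R ord_max]/bary unlift_none.
rewrite (eq_bigr (fun k : 'I_2 => 'X_k)) ?subrK // => k _.
by rewrite /bary liftK.
Qed.

(* The combination only involves r - r_b, so it is r times the sum of the
   coefficients minus a combination of the r_b; affine independence of the
   nodes then separates the three barycentric components. *)
Lemma half_rwg_comb_eq0 (c : cell M) (v : 'I_2 -> R) (g : 'I_3 -> R) :
  (forall x, \sum_b g b * (half_rwg c b x).@[v] = 0) ->
  forall l, rwg_scale c l * g l =
            (bary R l).@[v] * \sum_b rwg_scale c b * g b.
Proof.
move=> h; set S := \sum_b _.
pose z l := (bary R l).@[v] * S - rwg_scale c l * g l.
suff z0 l : z l = 0 by move=> l; apply/esym/eqP; rewrite -subr_eq0; apply/eqP/z0.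
have sum_bary_eval : \sum_l (bary R l).@[v] = 1.
  by rewrite -(raddf_sum (meval v)) sum_bary; apply: rmorph1.
apply: (affine_free c).
  by rewrite sumrB -mulr_suml sum_bary_eval mul1r subrr.
apply/rowP => x; rewrite summxE [RHS]mxE -[RHS](h x).
transitivity (S * (\sum_l (bary R l).@[v] * pos (node c l) 0 x)
  - \sum_b rwg_scale c b * g b * pos (node c b) 0 x).
  rewrite mulr_sumr -sumrB; apply: eq_bigr => k _; rewrite mxE /z; ring.
rewrite mulr_suml -sumrB; apply: eq_bigr => b _.
rewrite ffunE mevalZ mevalB mevalC raddf_sum /=.
rewrite -[opp_edge_len c b / _]/(rwg_scale c b) !mulrBr.
under [X in g b * (_ * X)]eq_bigr => k _ do rewrite mevalZ mulrC.
by ring.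
Qed.

End Geometry.


(** * Orthogonal projection onto the column space of a matrix *)

Section OrthogonalProjection.
Context {R : realType}.

Lemma gram_eq0 {m n} (A : 'M[R]_(m, n)) : A^T *m A = 0 -> A = 0.
Proof.
move=> h; apply/matrixP => i j; rewrite [RHS]mxE.
move/matrixP/(_ j j): h; rewrite !mxE => /eqP.
rewrite psumr_eq0 => [/allP/(_ i (mem_index_enum _))|k _]; last first.
  by rewrite [_^T _ _]mxE -expr2 sqr_ge0.
by rewrite [_^T _ _]mxE -expr2 sqrf_eq0 => /eqP.
Qed.

Variables (n m : nat) (A : 'M[R]_(n, m)).
Let P := A *m mpinv (A^T *m A) *m A^T.

(** The first Penrose identity shows that the columns of [A *m D] lie in the kernel of [A^T]; they
    also lie in the range of [A], so the Gram matrix of [A *m D] vanishes. *)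
Lemma gram_proj_id : P *m A = A.
Proof.
have /and4P[/eqP pinv1 _ _ _] := mpinvP (A^T *m A).
rewrite /P; set G := mpinv _ in pinv1 *; set D := G *m (A^T *m A) - 1%:M.
suff: A *m D = 0.
  by rewrite mulmxBr mulmx1 => /eqP; rewrite subr_eq0 => /eqP; rewrite !mulmxA.
have AAD : A^T *m (A *m D) = 0.
  by rewrite mulmxA mulmxBr mulmx1 [_ *m (G *m _)]mulmxA pinv1 subrr.
by apply: gram_eq0; rewrite trmx_mul -mulmxA AAD mulmx0.
Qed.

Lemma gram_proj_idem : P *m P = P.
Proof. by rewrite {2}/P !mulmxA gram_proj_id. Qed.

Lemma gram_proj_sym : P^T = P.
Proof.
(* This form needs no symmetry of the pseudoinverse: transposing [P *m A = A] absorbs the factor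
   [P^T]. *)
suff e : P *m P^T = P by rewrite -e trmx_mul trmxK.
by rewrite {1}/P -mulmxA -trmx_mul gram_proj_id.
Qed.

Lemma gram_proj_compl_projector :
  is_projector_onto (1%:M - P) (fun x => A^T *m x = 0).
Proof.
split=> [||x].
- by rewrite mulmxBr mulmx1 mulmxBl mul1mx gram_proj_idem subrr subr0.
- by rewrite linearB /= trmx1 gram_proj_sym.
split=> [x0|[y ->]].
  by exists x; rewrite mulmxBl mul1mx -mulmxA x0 mulmx0 subr0.
rewrite mulmxA mulmxBr mulmx1 -[P]gram_proj_sym -trmx_mul gram_proj_id.
by rewrite subrr mul0mx.
Qed.

(* A row vector orthogonal to the columns of all three blocks is itself in
   the kernel of A^T, hence orthogonal to itself. *)
Lemma row_free_kernel_complement k l (B : 'M[R]_(n, k)) (C : 'M[R]_(n, l)) :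
  (forall x : 'cV[R]_n, A^T *m x = 0 -> exists a b, x = B *m a + C *m b) ->
  row_free (row_mx A (row_mx B C)).
Proof.
move=> span; rewrite -kermx_eq0; apply/rowV0P => u /sub_kermxP.
rewrite !mul_mx_row => h.
have [uA hBC] := eq_row_mx (etrans h (esym (row_mx0 _ _ _ _))).
have [uB uC] := eq_row_mx (etrans hBC (esym (row_mx0 _ _ _ _))).
have [|a [b eu]] := span u^T; first by rewrite -trmx_mul uA trmx0.
rewrite -[u]trmxK (gram_eq0 u^T) ?trmx0 // trmxK eu mulmxDr !mulmxA uB uC.
by rewrite !mul0mx addr0.
Qed.

End OrthogonalProjection.


(** * Silvester polynomials at the interpolation nodes *)

Section Nodes.
Context {R : realType}.
Implicit Types (f : {mpoly R[2]}) (v : 'I_2 -> R).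

(** Only the first two barycentric coordinates k / n are stored; the third is k / n as well once the
    [k l] sum to n. *)
Definition node_point (n : nat) (k : 'I_3 -> nat) : 'I_2 -> R :=
  fun i => (k (lift ord_max i))%:R / n%:R.

Lemma bary_node_point {n} {k : 'I_3 -> nat} l : (0 < n)%N ->
  (\sum_l k l)%N = n -> (bary R l).@[node_point n k] = (k l)%:R / n%:R.
Proof.
move=> n0 sum_k; have nR0 : n%:R != 0 :> R by rewrite pnatr_eq0 -lt0n.
case: (unliftP ord_max l) => [i|] ->; first by rewrite /bary liftK mevalXU.
have := congr1 (meval (node_point n k)) (@sum_bary R).
rewrite (bigD1_ord ord_max) //= mevalD rmorph1 raddf_sum /=.
move/(canRL (addrK _)) ->; apply: (mulIf nR0).
rewrite divfK // mulrBl mul1r mulr_suml.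
rewrite (eq_bigr (fun i => (k (lift ord_max i))%:R)) => [|i _]; last first.
  by rewrite /bary liftK mevalXU divfK.
by rewrite -natr_sum -sum_k (bigD1_ord ord_max) //= natrD addrK.
Qed.

Lemma shifted_silvester_evalE {n k f v} i : (0 < n)%N ->
  f.@[v] = k%:R / n%:R ->
  (shifted_silvester n i f).@[v] =
  (i.-1`!%:R)^-1 * \prod_(1 <= t < i) (k%:R - t%:R).
Proof.
move=> n0 fv; rewrite mevalZ rmorph_prod; congr (_ * _).
apply: eq_bigr => t _; rewrite /= mevalB mevalZ fv rmorph_nat.
by rewrite mulrC divfK // pnatr_eq0 -lt0n.
Qed.

Lemma shifted_silvester_eval0 {n k f v i} : (0 < n)%N ->
  f.@[v] = k%:R / n%:R -> (0 < k < i)%N -> (shifted_silvester n i f).@[v] = 0.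
Proof.
move=> n0 fv ki; rewrite (shifted_silvester_evalE i n0 fv).
by rewrite (big_rem k) ?mem_index_iota //= subrr mul0r mulr0.
Qed.

Lemma shifted_silvester_eval_neq0 {n k f v i} : (0 < n)%N ->
  f.@[v] = k%:R / n%:R -> (i <= k)%N -> (shifted_silvester n i f).@[v] != 0.
Proof.
move=> n0 fv ik; rewrite (shifted_silvester_evalE i n0 fv).
rewrite mulf_neq0 ?invr_eq0 ?pnatr_eq0 -?lt0n ?fact_gt0 //.
rewrite big_seq prodf_seq_neq0; apply/allP => t.
rewrite mem_index_iota => /andP[_ ti]; apply/implyP => _.
by rewrite subr_eq0 eqr_nat gtn_eqF // (leq_trans ti).
Qed.

(** The factor of index 0, absent from the shifted polynomial, is [n%:R *: f]. *)
Lemma silvesterE n i f : (0 < i)%N ->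
  silvester n i f = (n%:R / i%:R) *: (f * shifted_silvester n i f).
Proof.
case: i => // i _; rewrite /silvester /shifted_silvester big_ltn // subr0 /=.
rewrite -scalerAr -scalerAl !scalerA factS natrM; congr (_ *: _).
by rewrite invfM; ring.
Qed.

(** The three candidates at an interior node share the product of shifted polynomials and differ
    only by xi_b and a constant. *)
Lemma gwp_cell_polyE {p} (m : inode p) b :
  gwp_cell_poly R m b = (p.+2%:R / (val m b)%:R) *:
    (bary R b * \prod_l shifted_silvester p.+2 (val m l) (bary R l)).
Proof.
have /andP[/forallP m0 _] := valP m.
rewrite /gwp_cell_poly silvesterE // -scalerAl; congr (_ *: _).
by rewrite [in RHS](bigD1 b) //= mulrA.
Qed.

(** Both multi-indices sum to p + 2, so componentwise domination would force equality. This gives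
    the triangularity at interior nodes. *)
Lemma inode_ltn {p} (m m' : inode p) : m' != m ->
  exists l, (val m l < val m' l)%N.
Proof.
move=> neq; apply/existsP; apply: contraNT neq => /existsPn le.
have /andP[_ /eqP s] := valP m; have /andP[_ /eqP s'] := valP m'.
have /leqif_sum[_] : forall l, true ->
    (val m' l <= val m l ?= iff (val m' l == val m l :> nat))%N.
  by move=> l _; split=> //; rewrite leqNgt le.
rewrite s s' eqxx => /esym/forallP eq.
by apply/eqP/val_inj/ffunP => l; apply/val_inj/eqP/eq.
Qed.

Lemma ord3_third (a b : 'I_3) : a != b ->
  exists c, [/\ c != a, c != b & forall l, l \in [:: a; b; c]].
Proof.
move=> ab; have /card_gt0P[c] : (0 < #|~: [set a; b]|)%N.
  by have := cardsC [set a; b]; rewrite cards2 ab card_ord; lia.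
rewrite !inE negb_or => /andP[ca cb]; exists c; split=> // l.
move: ab ca cb; rewrite !inE -!(inj_eq val_inj) /=.
by move: (ltn_ord a) (ltn_ord b) (ltn_ord c) (ltn_ord l); lia.
Qed.

End Nodes.

(** * Linear independence of the GWP functions *)

Section Independence.
Context {R : realType} {M : trimesh R} {p : nat}.
Variables (drop : cell M -> inode p -> 'I_3) (w : gwp_index M p -> R).

Lemma int_edge_neq (e : int_edge M) : (val e).1 != (val e).2.
Proof. by have /andP[+ _] := valP e; apply: contraTneq => ->; rewrite ltnn. Qed.

Lemma int_edge_ltn (e : int_edge M) :
  (enum_rank (val e).1 < enum_rank (val e).2)%N.
Proof. by have /andP[] := valP e. Qed.

(* The component of the n-th basis function along the half RWG function
   attached to node b of the cell c. *)
Definition gwp_coef (n : gwp_index M p) (c : cell M) (b : 'I_3) : {mpoly R[2]} :=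
  w n *: match n with
         | inl (e, i) =>
             if (c \in edge_cells (val e)) &&
                (node c b \notin [:: (val e).1; (val e).2])
             then edge_sign e c *: gwp_edge_poly e i c else 0
         | inr (c0, m, k) =>
             if (c == c0) && (b == lift (drop c0 m) k)
             then gwp_cell_poly R m b else 0
         end.

Lemma gwp_fieldE n c x :
  gwp_field drop w n c x = \sum_b gwp_coef n c b * half_rwg c b x.
Proof.
rewrite /gwp_field /gwp_coef; case: n => [[e i]|[[c0 m] k]].
  rewrite !ffunE; have [ce|_] /= := boolP (c \in _); last first.
    by rewrite ffunE mulr0 scaler0 big1 // => b _; rewrite mul0r.
  rewrite ffunE sum_ffunE -scalerAr !scalerA mulr_sumr scaler_sumr big_mkcond.
  apply: eq_bigr => b _; case: ifP => _; last by rewrite scaler0 mul0r.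
  by rewrite scalerA -scalerAl.
rewrite !ffunE; case: eqP => [->|_] /=; last first.
  by rewrite ffunE scaler0 big1 // => b _; rewrite ?scaler0 mul0r.
rewrite ffunE (bigD1 (lift (drop c0 m) k)) //= eqxx -scalerAl big1 ?addr0 //.
by move=> b /negPf ->; rewrite ?scaler0 mul0r.
Qed.

Lemma gwp_edge_poly_eval0 (e : int_edge M) (i j : 'I_p.+1) (c : cell M) v :
  c \in edge_cells (val e) -> i != j ->
  (forall l, (bary R l).@[v] = (edge_mult e j (node c l))%:R / p.+2%:R) ->
  (gwp_edge_poly e i c).@[v] = 0.
Proof.
rewrite inE => /andP[/imsetP[la _ ea] /imsetP[lb _ eb]] ij ev.
have ab := negPf (int_edge_neq e).
suff [l /(shifted_silvester_eval0 (ltn0Sn _) (ev l)) l0] :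
    exists l, (0 < edge_mult e j (node c l) < edge_mult e i (node c l))%N.
  by rewrite rmorph_prod (bigD1 l) //= l0 mul0r.
(* The multiplicity increases with the node index at the first end of the edge and decreases at the
   second, so the end to use depends on the order of i and j. *)
have [ltij|ltji|eij] := ltngtP i j; last by rewrite -(inj_eq val_inj) /= eij eqxx in ij.
  exists lb; rewrite -eb /edge_mult eq_sym ab eqxx.
  by rewrite subn_gt0 ltn_ord /=; have := ltn_ord j; lia.
by exists la; rewrite -ea /edge_mult eqxx.
Qed.

Lemma gwp_edge_poly_eval_neq0 (e : int_edge M) (i : 'I_p.+1) (c : cell M) v :
  (forall l, (bary R l).@[v] = (edge_mult e i (node c l))%:R / p.+2%:R) ->
  (gwp_edge_poly e i c).@[v] != 0.
Proof.
move=> ev; rewrite rmorph_prod /=; apply/prodf_neq0 => l _.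
exact: shifted_silvester_eval_neq0 (ev l) _.
Qed.

Lemma edge_sign_neq0 (e : int_edge M) c : edge_sign e c != 0.
Proof. by rewrite /edge_sign; case: ifP; rewrite ?oppr_eq0 oner_eq0. Qed.

Section Relation.
Variable a : gwp_index M p -> R.
Hypothesis w_neq0 : forall n, w n != 0.
Hypothesis rel0 : \sum_n a n *: gwp_field drop w n = 0.

Let g c v b := \sum_n a n * (gwp_coef n c b).@[v].

(** On the cell c, [g c v b] is the coefficient of the global relation along the half RWG function
    of node b, so [half_rwg_comb_eq0] applies. *)
Lemma gwp_relation_local c v l :
  rwg_scale c l * g c v l = (bary R l).@[v] * \sum_b rwg_scale c b * g c v b.
Proof.
move: l; apply: half_rwg_comb_eq0 => x.
transitivity ((\sum_n a n *: gwp_field drop w n) c x).@[v]; last first.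
  by rewrite rel0 !ffunE meval0.
have scaleE r (u : vfield M) : (r *: u) c x = r *: u c x by rewrite !ffunE.
rewrite !sum_ffunE raddf_sum /=.
under [RHS]eq_bigr => n _.
  rewrite scaleE mevalZ gwp_fieldE raddf_sum mulr_sumr; over.
rewrite exchange_big; apply: eq_bigr => b _; rewrite mulr_suml.
by apply: eq_bigr => n _; rewrite /= mevalM mulrA.
Qed.

Lemma gwp_relation_edge (e : int_edge M) (j : 'I_p.+1) : a (inl (e, j)) = 0.
Proof.
have ab := negPf (int_edge_neq e).
have /card_gt0P[c ce] : (0 < #|edge_cells (val e)|)%N.
  by have /andP[_ /eqP ->] := valP e.
have := ce; rewrite inE => /andP[/imsetP[la _ ea] /imsetP[lb _ eb]].
(* The node b is opposite to e; its half RWG function is the one carrying e on c. *)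
have [|b [ba bb ball]] := @ord3_third la lb.
  by apply: contraFneq ab => lab; rewrite ea eb lab.
pose k l := edge_mult e j (node c l).
have ka : k la = j.+1 by rewrite /k -ea /edge_mult eqxx.
have kb : k lb = (p.+1 - j)%N by rewrite /k -eb /edge_mult eq_sym ab eqxx.
have nb : node c b \notin [:: (val e).1; (val e).2].
  by rewrite !inE ea eb !(inj_eq (@node_inj _ _ c)) negb_or ba bb.
have k0 : k b = 0%N.
  by move: nb; rewrite !inE negb_or /k /edge_mult => /andP[/negPf -> /negPf ->].
have sum_k : (\sum_l k l)%N = p.+2.
  rewrite (bigD1 la) // (bigD1 lb) /=; last first.
    by apply: contraFneq ab => lab; rewrite ea eb lab.
  rewrite big1 ?ka ?kb => [|l /andP[nla nlb]]; last first.
    by have := ball l; rewrite !inE (negPf nla) (negPf nlb) => /eqP ->.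
  by have := ltn_ord j; lia.
set v : 'I_2 -> R := node_point p.+2 k.
have ev l : (bary R l).@[v] = (k l)%:R / p.+2%:R by apply: bary_node_point.
have g0 : g c v b = 0.
  apply: (mulfI (rwg_scale_neq0 c b)).
  by rewrite gwp_relation_local ev k0 mul0r mul0r mulr0.
have : a (inl (e, j)) * (gwp_coef (inl (e, j)) c b).@[v] = 0.
  rewrite -[RHS]g0 /g (bigD1 (inl (e, j))) //= [X in _ + X]big1 ?addr0 //.
  case=> [[e' i]|[[c0 m] q]] neq; rewrite /gwp_coef mevalZ.
    case: ifP => [/andP[ce' nb']|_]; last by rewrite meval0 !mulr0.
    (* An interior edge of c avoiding node b has the same ends as e, and the increasing enumeration
       order fixes the pair. *)
    have ee' : e' = e.
      have sub u : u \in cell_nodes c -> u != node c b ->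
          (u == (val e).1) || (u == (val e).2).
        move=> /imsetP[l _ ->]; have := ball l; rewrite !inE.
        by case/or3P => /eqP ->; rewrite -?ea -?eb eqxx ?orbT.
      move: ce' nb'; rewrite !inE negb_or ![node c b == _]eq_sym.
      case/andP=> /sub s1 /sub s2 /andP[/s1 h1 /s2 h2].
      have := int_edge_ltn e'; have := int_edge_ltn e; have := int_edge_neq e'.
      move: h1 h2; case: e' {neq s1 s2} => -[u1 u2] /= he' h1 h2 ne lt lt'.
      apply/val_inj => /=; rewrite [RHS]surjective_pairing.
      case/orP: h1 => /eqP e1; case/orP: h2 => /eqP e2; subst u1 u2 => //;
        by rewrite ?eqxx // in ne; rewrite /= in lt'; lia.
    subst e'; rewrite mevalZ (gwp_edge_poly_eval0 _ _ _ _ _ ce _ ev) ?mulr0 //.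
    by apply: contraNneq neq => ->.
  (* A cell function along b carries the factor xi_b, which is zero at v. *)
  case: ifP => [_|_]; last by rewrite meval0 !mulr0.
  by rewrite gwp_cell_polyE mevalZ mevalM ev k0 !(mul0r, mulr0).
rewrite /gwp_coef ce nb !mevalZ => /eqP.
rewrite !mulf_eq0 (negPf (w_neq0 _)) (negPf (edge_sign_neq0 _ _)).
by rewrite (negPf (gwp_edge_poly_eval_neq0 _ _ _ _ ev)) !orbF => /eqP.
Qed.

Lemma gwp_relation_cell (c : cell M) (m : inode p) (q : 'I_2) :
  a (inr (c, m, q)) = 0.
Proof.
have /andP[/forallP m0 /eqP sum_m] := valP m.
set v : 'I_2 -> R := node_point p.+2 (fun l => val m l).
have ev l : (bary R l).@[v] = (val m l)%:R / p.+2%:R by apply: bary_node_point.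
have bary_neq0 l : (bary R l).@[v] != 0.
  by rewrite ev mulf_neq0 ?invr_eq0 ?pnatr_eq0 // -lt0n.
(* Edge coefficients are already zero, and functions of other interior nodes vanish at v by
   [inode_ltn]; only the two functions kept at m remain. *)
have gE b : g c v b =
    \sum_q a (inr (c, m, q)) * (gwp_coef (inr (c, m, q)) c b).@[v].
  rewrite /g big_sumType /= big1 ?add0r; last first.
    by case=> e i _; rewrite gwp_relation_edge mul0r.
  pose F cm q := a (inr (cm, q)) * (gwp_coef (inr (cm, q)) c b).@[v].
  transitivity (\sum_cm \sum_q F cm q).
    by rewrite pair_bigA /=; apply: eq_bigr => -[].
  rewrite (bigD1 (c, m)) //= [X in _ + X]big1 ?addr0 //.
  case=> c' m' neq; apply: big1 => k _; rewrite /F mevalZ.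
  case: ifP => [/andP[/eqP cc' _]|_]; last by rewrite meval0 !mulr0.
  have [|l lt_l] := @inode_ltn _ m m'; first by apply: contraNneq neq => ->; rewrite cc'.
  have s0 : (shifted_silvester p.+2 (val m' l) (bary R l)).@[v] = 0.
    by apply: shifted_silvester_eval0 (ev l) _; rewrite ?m0.
  rewrite gwp_cell_polyE mevalZ mevalM rmorph_prod [\prod_l _](bigD1 l) //= s0.
  by rewrite !(mul0r, mulr0).
(* Neither kept function has a component along the discarded candidate, while its barycentric
   coordinate is nonzero at v. *)
have S0 : \sum_b rwg_scale c b * g c v b = 0.
  apply: (mulfI (bary_neq0 (drop c m))).
  rewrite -gwp_relation_local gE big1 ?mulr0 // => k _.
  by rewrite mevalZ eqxx (negPf (neq_lift _ _)) meval0 !mulr0.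
have : g c v (lift (drop c m) q) = 0.
  by apply: (mulfI (rwg_scale_neq0 c (lift (drop c m) q)));
     rewrite gwp_relation_local S0 !mulr0.
rewrite gE (bigD1 q) //= big1 ?addr0 => [|k neq]; last first.
  by rewrite mevalZ (inj_eq lift_inj) eq_sym (negPf neq) andbF meval0 !mulr0.
rewrite mevalZ !eqxx /= gwp_cell_polyE mevalZ mevalM => /eqP.
rewrite !mulf_eq0 (negPf (w_neq0 _)) (negPf (bary_neq0 _)) invr_eq0.
rewrite !pnatr_eq0 !eqn0Ngt m0 /= rmorph_prod /= prodf_seq_eq0 => /orP[/eqP //|].
case/hasP=> l _ /=; apply: contraTeq => _.
exact: shifted_silvester_eval_neq0 (ev l) _.
Qed.

End Relation.

Lemma gwp_field_free (a : gwp_index M p -> R) : (forall n, w n != 0) ->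
  \sum_n a n *: gwp_field drop w n = 0 -> forall n, a n = 0.
Proof.
move=> w0 rel [[e i]|[[c m] k]]; first exact: gwp_relation_edge.
exact: gwp_relation_cell.
Qed.

Lemma gwp_comb_inj : (forall n, w n != 0) -> injective (gwp_comb drop w).
Proof.
move=> w0 x y exy; apply/eqP; rewrite -subr_eq0; apply/eqP.
pose f := cast_ord (card_gwp_index M p).
have bijf : bijective f.
  exists (cast_ord (esym (card_gwp_index M p))) => z; first exact: cast_ordK.
  exact: cast_ordKV.
pose a n : R := (x - y) (f (enum_rank n)) 0.
suff a0 n : a n = 0.
  apply/colP => i; rewrite [RHS]mxE.
  rewrite -(a0 (enum_val (cast_ord (esym (card_gwp_index M p)) i))).
  by rewrite /a enum_valK /f cast_ordKV.
move: n; apply: gwp_field_free => //.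
have : gwp_comb drop w x - gwp_comb drop w y = 0 by rewrite exy subrr.
rewrite /gwp_comb -sumrB => e; rewrite -[RHS]e.
rewrite [RHS](reindex f) /=; last exact: onW_bij.
rewrite [RHS](reindex enum_rank) /=; last exact/onW_bij/enum_rank_bij.
apply: eq_bigr => n _; rewrite /a /f /gwp cast_ordK enum_rankK.
by rewrite [in LHS]mxE [in LHS]mxE scalerBl.
Qed.

End Independence.


(** * Kernel and rank of the Star matrix *)

Section Star.
Context {R : realType} {M : trimesh R} {p : nat}.
Variables (drop : cell M -> inode p -> 'I_3) (w : gwp_index M p -> R).

Lemma sdiv_gwp_comb (x : 'cV[R]_(Np M p)) :
  sdiv (gwp_comb drop w x) = \sum_n x n 0 *: sdiv (gwp drop w n).
Proof.
apply/ffunP => c; rewrite sum_ffunE ffunE.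
have scaleE r (u : vfield M) y : (r *: u) c y = r *: u c y by rewrite !ffunE.
under [RHS]eq_bigr => n _ do rewrite ffunE [sdiv _ _]ffunE scaler_sumr.
rewrite [RHS]exchange_big; apply: eq_bigr => k _ /=.
under [RHS]eq_bigr => n _ do rewrite scaler_sumr.
rewrite [RHS]exchange_big; apply: eq_bigr => y _ /=.
rewrite !sum_ffunE (raddf_sum (mderiv k)) scaler_sumr; apply: eq_bigr => n _ /=.
by rewrite scaleE linearZ /= !scalerA mulrC.
Qed.

(** By linearity, [Sigma^T *m x] is the transposed image under [L] of the divergence of the
    combination. *)
Lemma star_mx_ker m (L : {linear pwpoly M p -> 'rV[R]_m}) : injective L ->
  forall x, (star_mx drop w L)^T *m x = 0 <-> solenoidal_coef drop w x.
Proof.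
move=> L_inj x; set D := \sum_n x n 0 *: div_gwp drop w n.
have -> : (star_mx drop w L)^T *m x = (L D)^T.
  apply/colP => j; rewrite !mxE raddf_sum summxE; apply: eq_bigr => n _ /=.
  by rewrite linearZ /= !mxE mulrC.
have valD : val D = sdiv (gwp_comb drop w x).
  by rewrite sdiv_gwp_comb (raddf_sum val).
rewrite /solenoidal_coef /solenoidal -valD; split=> [|D0].
  move/(congr1 trmx); rewrite trmxK trmx0 -(raddf0 L) => /L_inj ->.
  exact: raddf0.
by rewrite (_ : D = 0) ?raddf0 ?trmx0 //; apply: val_inj; rewrite D0 raddf0.
Qed.

(* Reading off coefficients turns a basis of the solenoidal functions into a
   basis of the kernel because the basis functions are independent. *)
Lemma rank_star_mx m (L : {linear pwpoly M p -> 'rV[R]_m}) d :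
  (forall n, w n != 0) -> injective L -> has_dim (gwp_solenoidal drop w) d ->
  (\rank (star_mx drop w L) + d)%N = Np M p.
Proof.
move=> w0 L_inj [b [b_free b_span]]; set S := star_mx drop w L.
have comb_sum n (a : 'I_n -> R) (X : 'I_n -> 'cV[R]_(Np M p)) :
    gwp_comb drop w (\sum_i a i *: X i) = \sum_i a i *: gwp_comb drop w (X i).
  rewrite /gwp_comb; under [RHS]eq_bigr => i _ do rewrite scaler_sumr.
  rewrite [RHS]exchange_big; apply: eq_bigr => k _ /=.
  rewrite summxE scaler_suml; apply: eq_bigr => i _.
  by rewrite mxE scalerA.
have b_sol i : gwp_solenoidal drop w (b i).
  apply/b_span; exists (fun k => (k == i)%:R); rewrite (bigD1 i) //= eqxx scale1r.
  by rewrite big1 ?addr0 // => k /negPf ->; rewrite scale0r.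
have [X bX] : exists X : 'I_d -> 'cV[R]_(Np M p),
    forall i, b i = gwp_comb drop w (X i).
  apply: (@fin_all_exists _ _ (fun i x => b i = gwp_comb drop w x)) => i.
  by case: (b_sol i).
have comb_b a : \sum_i a i *: b i = gwp_comb drop w (\sum_i a i *: X i).
  by rewrite comb_sum; apply: eq_bigr => i _; rewrite bX.
(* The rows are the coefficient vectors of the solenoidal basis; they will form a basis of the left
   kernel of [S]. *)
pose B := \matrix_i (X i)^T.
have mulB (u : 'rV_d) : u *m B = (\sum_i u 0 i *: X i)^T.
  rewrite mulmx_sum_row raddf_sum; apply: eq_bigr => i _.
  by rewrite rowK /= linearZ.
have comb0 : gwp_comb drop w 0 = 0.
  by rewrite /gwp_comb big1 // => n _; rewrite mxE scale0r.
have Bfree : row_free B.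
  rewrite -kermx_eq0; apply/rowV0P => u /sub_kermxP.
  rewrite mulB => /(congr1 trmx); rewrite trmxK trmx0 => u0.
  apply/rowP => i; rewrite [RHS]mxE; apply: (b_free (u 0)).
  by rewrite comb_b u0 comb0.
have kerB : (B == kermx S)%MS.
  apply/andP; split.
    apply/row_subP => i; rewrite rowK; apply/sub_kermxP.
    rewrite -[S]trmxK -trmx_mul (proj2 (star_mx_ker m L L_inj (X i))) ?trmx0 //.
    by rewrite /solenoidal_coef -bX; case: (b_sol i).
  apply/row_subP => i; set u := row i _.
  have uS : S^T *m u^T = 0.
    by rewrite -trmx_mul (sub_kermxP (row_sub _ _)) trmx0.
  have [a ua] : exists a, gwp_comb drop w u^T = \sum_k a k *: b k.
    apply/b_span; split; first by exists u^T.
    exact/(star_mx_ker m L L_inj).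
  apply/submxP; exists (\row_k a k); rewrite mulB -[LHS]trmxK; congr (_^T).
  (* Equality of functions gives equality of coefficients. *)
  apply: (gwp_comb_inj drop w w0); rewrite ua comb_b.
  by congr gwp_comb; apply: eq_bigr => k _; rewrite mxE.
have := eqmx_rank kerB; rewrite mxrank_ker (eqP Bfree) => ->.
by rewrite subnKC // rank_leq_row.
Qed.

End Star.

(** * The quasi-Helmholtz decomposition and its projectors *)

Theorem mainTheorem3 (R : realType) (M : trimesh R) (p : nat)
  (drop : cell M -> inode p -> 'I_3) (w : gwp_index M p -> R)
  (w_neq0 : forall n, w n != 0)
  (dim_solenoidal : exists d : nat,
     has_dim (gwp_solenoidal drop w) d /\
     (d + Mp M p = Np M p + num_bodies M)%N)
  (nL nH : nat) (Lambda : 'M[R]_(Np M p, nL)) (H : 'M[R]_(Np M p, nH))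
  (Lambda_solenoidal : forall j, solenoidal_coef drop w (col j Lambda))
  (H_solenoidal : forall j, solenoidal_coef drop w (col j H))
  (Lambda_H_span : forall x, solenoidal_coef drop w x ->
     exists a b, x = Lambda *m a + H *m b)
  (m : nat) (L : {linear pwpoly M p -> 'rV[R]_m}) (L_inj : injective L) :
  let Sigma := star_mx drop w L in
  let PSigma := Sigma *m mpinv (Sigma^T *m Sigma) *m Sigma^T in
  let PLambdaH := 1%:M - PSigma in
  [/\ Sigma^T *m Lambda = 0 /\ Sigma^T *m H = 0,
      (forall x : 'cV[R]_(Np M p),
         Sigma^T *m x = 0 <-> solenoidal_coef drop w x) /\
      \rank Sigma = (Mp M p - num_bodies M)%N,
      \rank (row_mx Sigma (row_mx Lambda H)) = Np M p /\
      (forall x : 'cV[R]_(Np M p), exists y,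
         x = row_mx Sigma (row_mx Lambda H) *m y)
    & [/\ PSigma *m PLambdaH = 0, PLambdaH *m PSigma = 0
        & is_projector_onto PLambdaH (solenoidal_coef drop w)]].
Proof.
move=> Sigma PSigma PLambdaH.
have ker := star_mx_ker drop w m L L_inj; rewrite -/Sigma in ker.
have kerM n (A : 'M[R]_(Np M p, n)) :
    (forall j, solenoidal_coef drop w (col j A)) -> Sigma^T *m A = 0.
  move=> sol; apply/matrixP => i j.
  have /ker := sol j; rewrite colE mulmxA -colE => /colP/(_ i).
  by rewrite [LHS]mxE => ->; rewrite !mxE.
have free : row_free (row_mx Sigma (row_mx Lambda H)).
  by apply: row_free_kernel_complement => x /ker/Lambda_H_span.
split; [by split; apply: kerM | split=> // | split | split].
- have [d [dimd eqd]] := dim_solenoidal.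
  (* Cancelling d gives rank + [num_bodies] = [Mp], so the truncated subtraction is exact. *)
  have := rank_star_mx drop w m L d w_neq0 L_inj dimd; rewrite -/Sigma; lia.
- exact/eqP.
- move=> x; have /row_freeP[B AB] := free.
  by exists (B *m x); rewrite mulmxA AB mul1mx.
- by rewrite mulmxBr mulmx1 gram_proj_idem subrr.
- by rewrite mulmxBl mul1mx gram_proj_idem subrr.
have [idem sym onto] := gram_proj_compl_projector _ _ Sigma.
split=> // x; apply: iff_trans (onto x).
exact: iff_sym.
Qed.
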